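(* Let $L$ be the Lemke graph and let $L\,\square\,L$ be its Cartesian product with itself. Then $\pi(L\,\square\,L,(r_1,r_2))\le 96$ for all vertices $(r_1,r_2)\in V(L\,\square\,L)$, where $\pi(G,r)$ denotes the rooted pebbling number of $G$ with root $r$.
   Context: A configuration of pebbles on a simple connected undirected graph $G=(V,E)$ is a function $C:V\to\mathbb{Z}_{\ge 0}$; its size is $|C|=\sum_{v\in V}C(v)$. A pebbling move from $u$ to $v$ along an edge $\{u,v\}\in E$ removes two pebbles from $u$ (which must have at least two) and places one pebble on $v$. A pebble can be moved to a vertex $r$ from $C$ if some finite (possibly empty) sequence of pebbling moves starting at $C$ results in a configuration with at least one pebble on $r$. The rooted pebbling number $\pi(G,r)$ is the smallest integer $k$ such that from every configuration of size $k$ one pebble can be moved to $r$. The Cartesian product $G_1\,\square\,G_2$ of $G_1=(V_1,E_1)$ and $G_2=(V_2,E_2)$ has vertex set $V_1\times V_2$, and $(v_1,v_2)$ is adjacent to $(u_1,u_2)$ if and only if either $v_1=u_1$ and $\{v_2,u_2\}\in E_2$, or $v_2=u_2$ and $\{v_1,u_1\}\in E_1$. The Lemke graph $L$ has vertex set $\{v_1,\dots,v_8\}$ and the following 13 edges, where $i$–$j$ denotes the edge $\{v_i,v_j\}$: 8–5, 8–7, 8–6, 7–3, 7–4, 6–3, 6–4, 5–3, 5–4, 4–2, 3–1, 2–1, 8–4. *)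

(* Defs.v *)
From mathcomp Require Import all_boot.
From mathcomp Require Import boolp.

Set Implicit Arguments.
Unset Strict Implicit.
Unset Printing Implicit Defensive.

Record connected_graph := ConnectedGraph {
  vertex :> finType;
  adj : rel vertex;
  adj_sym : symmetric adj;
  adj_irr : irreflexive adj;
  adj_connected : forall u v, connect adj u v
}.

Section Pebbling.
Variable G : connected_graph.

Definition configuration := {ffun G -> nat}.
Implicit Types (C D : configuration) (r u v w : G).

Definition config_size C := \sum_(v : G) C v.

(* The subtraction is truncated; moves are only ever made when 2 <= C u. *)
Definition move_along C u v : configuration :=
  [ffun w => C w - 2 * (w == u) + (w == v)].

Definition pebbling_move : rel configuration := fun C D =>
  [exists u, exists v, [&& adj u v, 2 <= C u & D == move_along C u v]].

Definition pebble_movable C r : Prop :=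
  exists2 s : seq configuration, path pebbling_move C s & 0 < last C s r.

Definition all_movable r (k : nat) : Prop :=
  forall C, config_size C = k -> pebble_movable C r.

Lemma move_many m C u v : adj u v -> 2 * m <= C u ->
  exists2 s, path pebbling_move C s & m <= last C s v.
Proof.
move=> uv leC.
have neq_uv : u != v by apply/eqP=> e; rewrite e adj_irr in uv.
suff [s [ps ls _]] : exists s, [/\ path pebbling_move C s,
    m <= last C s v & C u - 2 * m <= last C s u] by exists s.
elim: m leC => [|n IHn] leC; first by exists [::]; rewrite muln0 subn0.
have [|s [ps lv lu]] := IHn; first by apply: leq_trans leC; rewrite leq_mul.
have le2 : 2 <= last C s u.
  by apply: leq_trans lu; rewrite leq_subRL ?mulnS 1?addnC -?mulnS //;
     apply: leq_trans leC; rewrite leq_mul.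
exists (rcons s (move_along (last C s) u v)); rewrite rcons_path last_rcons ps.
split=> /=.
- by apply/existsP; exists u; apply/existsP; exists v; rewrite uv le2 eqxx.
- by rewrite ffunE eqxx (eq_sym v) (negPf neq_uv) muln0 subn0 addn1.
- rewrite ffunE eqxx (negPf neq_uv) muln1 addn0 mulnS addnC subnDA.
  exact: leq_sub2r.
Qed.

Lemma move_path p C u : path (@adj G) u p -> 2 ^ size p <= C u ->
  pebble_movable C (last u p).
Proof.
elim: p C u => [|v p IHp] C u /=; first by move=> _ C_gt0; exists [::].
case/andP=> uv vp; rewrite expnS => /(move_many uv)[s ps /(IHp _ _ vp)[t pt lt]].
by exists (s ++ t); rewrite ?last_cat // cat_path ps.
Qed.

Lemma all_movable_exists r : exists k, `[< all_movable r k >].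
Proof.
exists (#|G| * 2 ^ #|G|); apply/asboolP => C sizeC.
have [u leCu] : exists u, 2 ^ #|G| <= C u.
  apply/existsP; apply: contraT; rewrite negb_exists => /forallP ltC.
  suff : config_size C < #|G| * 2 ^ #|G| by rewrite sizeC ltnn.
  rewrite -sum_nat_const /config_size (bigD1 r) //= [X in _ < X](bigD1 r) //=.
  rewrite -addSn leq_add // ?ltnNge ?ltC //.
  by apply: leq_sum => v _; rewrite ltnW // ltnNge ltC.
have /connectP[p up ->] := adj_connected u r.
have [q uq Uq _] := shortenP up.
apply: move_path => //; apply: leq_trans leCu.
rewrite leq_exp2l //; apply: leq_trans (leqnSn _) _.
by rewrite -[X in X <= _](card_uniqP Uq) max_card.
Qed.

Definition rooted_pebbling_number r : nat := ex_minn (all_movable_exists r).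

End Pebbling.

Arguments rooted_pebbling_number : clear implicits.

Section CartesianProduct.
Variables G1 G2 : connected_graph.

Definition cart_adj : rel (G1 * G2) := fun v u =>
  ((v.1 == u.1) && adj v.2 u.2) || ((v.2 == u.2) && adj v.1 u.1).

Lemma cart_adj_sym : symmetric cart_adj.
Proof.
move=> v u; rewrite /cart_adj (eq_sym v.1) (eq_sym v.2).
by rewrite (adj_sym v.1) (adj_sym v.2).
Qed.

Lemma cart_adj_irr : irreflexive cart_adj.
Proof. by move=> v; rewrite /cart_adj !adj_irr !andbF. Qed.

Lemma cart_adj_connected u v : connect cart_adj u v.
Proof.
have homo1 (w : G2) x y : connect (@adj G1) x y -> connect cart_adj (x, w) (y, w).
  case/connectP=> p; elim: p x => [|z p IHp] x /=; first by move=> _ ->.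
  case/andP=> xz zp ly; apply: connect_trans (IHp z zp ly).
  by apply: connect1; rewrite /cart_adj /= eqxx xz orbT.
have homo2 (w : G1) x y : connect (@adj G2) x y -> connect cart_adj (w, x) (w, y).
  case/connectP=> p; elim: p x => [|z p IHp] x /=; first by move=> _ ->.
  case/andP=> xz zp ly; apply: connect_trans (IHp z zp ly).
  by apply: connect1; rewrite /cart_adj /= eqxx xz.
case: u v => [u1 u2] [v1 v2]; apply: (@connect_trans _ _ (v1, u2)).
  exact/homo1/adj_connected.
exact/homo2/adj_connected.
Qed.

Definition cartesian_product : connected_graph :=
  ConnectedGraph cart_adj_sym cart_adj_irr cart_adj_connected.

End CartesianProduct.

Definition lemke_edges : seq (nat * nat) :=
  [:: (8, 5); (8, 7); (8, 6); (7, 3); (7, 4); (6, 3); (6, 4);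
      (5, 3); (5, 4); (4, 2); (3, 1); (2, 1); (8, 4)].

(* The vertex v_i is the ordinal of value i - 1. *)
Definition lemke_adj : rel 'I_8 := fun i j =>
  ((i.+1, j.+1) \in lemke_edges) || ((j.+1, i.+1) \in lemke_edges).

Lemma lemke_adj_sym : symmetric lemke_adj.
Proof. by move=> i j; rewrite /lemke_adj orbC. Qed.

Lemma lemke_adj_irr : irreflexive lemke_adj.
Proof. by case=> [[|[|[|[|[|[|[|[|n]]]]]]]] lt_n8]. Qed.

Lemma lemke_adj_connected i j : connect lemke_adj i j.
Proof.
suff to3 k : connect lemke_adj k (@Ordinal 8 3 isT).
  apply: connect_trans (to3 i) _.
  by rewrite (same_connect_r _ (to3 j)) // => x y;
     apply: sym_connect_sym; apply: lemke_adj_sym.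
have step a b : lemke_adj a b -> connect lemke_adj b (@Ordinal 8 3 isT) ->
    connect lemke_adj a (@Ordinal 8 3 isT).
  by move=> ab; apply: connect_trans; apply: connect1.
have c4 : connect lemke_adj (@Ordinal 8 4 isT) (@Ordinal 8 3 isT).
  exact: connect1.
have c1 : connect lemke_adj (@Ordinal 8 1 isT) (@Ordinal 8 3 isT).
  exact: connect1.
case: k => [[|[|[|[|[|[|[|[|n]]]]]]]] lt_n8] //.
- exact: step c1.
- exact: connect1.
- exact: step c4.
- by apply: eq_connect0; apply: val_inj.
- exact: connect1.
- exact: connect1.
- exact: connect1.
- exact: connect1.
Qed.

Definition lemke_graph : connected_graph :=
  ConnectedGraph lemke_adj_sym lemke_adj_irr lemke_adj_connected.

(* Main.v *)
Require Import Defs.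
From mathcomp Require Import all_boot.
From mathcomp Require Import boolp zify.
From Stdlib Require Import NArith.

(** The bound is a weight function argument.  Let [w] be a nonnegative weight
    on the vertices such that every vertex of positive weight is adjacent to
    the root, or to a vertex at least twice as heavy: for instance, a tree
    hanging from the root in which the weight is halved at each step away from
    it.  If a configuration [C] satisfies [sum w v * C v > sum w v], then some
    vertex of positive weight holds two pebbles.  If it is adjacent to the root,
    the root is reached in one move; otherwise, moving to its heavier neighbour
    does not decrease [sum w v * C v] and decreases the number of pebbles, so
    that repeating such moves ends with a pebble on the root
    ([tree_strategy_movable]).  A configuration from which the root cannot be
    reached therefore satisfies [sum w v * C v <= sum w v].

    These linear inequalities can be added, scaled, and transported by the
    automorphisms of the graph.  If a nonnegative combination of them has all
    its coefficients at least [m] outside the root and its right-hand side less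
    than [m * 96], then no configuration of 96 pebbles satisfies it, and
    the rooted pebbling number is at most 96 ([rooted_pebbling_number_le]).

    For the square of the Lemke graph, the vertices v5, v6, v7 have the same
    neighbours, which gives 72 symmetries: a permutation of v5, v6, v7 in each
    coordinate, possibly followed by the exchange of the coordinates.  Up to
    these symmetries there are 22 roots.  For each of them a list of at most
    nine weighted trees is given; averaging the combined weight over the
    symmetries that fix the root yields coefficients that satisfy the criterion.
    What remains is a finite verification in integer arithmetic. *)

Set Implicit Arguments.
Unset Strict Implicit.
Unset Printing Implicit Defensive.

(** * Weight functions *)

Section WeightFunctions.
Variable G : connected_graph.
Implicit Types (C D : configuration G) (r u v : G) (w : G -> nat).

(** Each vertex of positive weight has a next step towards the root [r], along
    which the weight at least doubles unless the step ends at [r].  Following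
    these steps leads to [r]. *)
Definition tree_strategy r w := forall v, 0 < w v ->
  exists2 u, adj v u & (u == r) || (2 * w v <= w u).

(** The linear inequality of coefficients [w] and right-hand side [b] holds for
    every configuration from which no pebble can be moved to [r]. *)
Definition weight_bound r w b := forall C, ~ pebble_movable C r ->
  \sum_v w v * C v <= b.

Lemma sum_move_along w C u v : 2 <= C u ->
  \sum_x w x * move_along C u v x + 2 * w u = \sum_x w x * C x + w v.
Proof.
move=> Cu; have pick1 y : \sum_x w x * (x == y) = w y.
  rewrite -[RHS](big_pred1_eq addn) big_mkcond; apply: eq_bigr => x _.
  by case: eqP; rewrite ?muln1 ?muln0.
rewrite -(pick1 u) -(pick1 v) big_distrr -!big_split; apply: eq_bigr => x _.
rewrite ffunE /=; case: eqP => [->|_]; case: eqP => _; nia.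
Qed.

Lemma pebble_movable_move C u v r : adj u v -> 2 <= C u ->
  pebble_movable (move_along C u v) r -> pebble_movable C r.
Proof.
move=> uv Cu [s ps ls]; exists (move_along C u v :: s) => //=.
by rewrite ps andbT; apply/existsP; exists u; apply/existsP; exists v;
   rewrite uv Cu eqxx.
Qed.

(** The weight function lemma. *)
Lemma tree_strategy_movable r w C : tree_strategy r w ->
  \sum_v w v < \sum_v w v * C v -> pebble_movable C r.
Proof.
move=> strat_w; have [n] := ubnP (config_size C).
elim: n C => // n IHn C size_C heavy_C.
have [v w_gt0 C_ge2] : exists2 v, 0 < w v & 2 <= C v.
  apply/exists_inP; apply: contraLR heavy_C => /exists_inPn light.
  rewrite -leqNgt; apply: leq_sum => v _.
  by have [|/light] := posnP (w v); nia.
(* A move from [v] to [u] loses [2 * w v], gains [w u], and makes the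
   configuration smaller. *)
have [u vu] := strat_w v w_gt0.
have lighter: config_size (move_along C v u) < n.
  have := sum_move_along (fun=> 1) u C_ge2.
  by under eq_bigr do rewrite mul1n; under [in RHS]eq_bigr do rewrite mul1n;
     rewrite -/(config_size _) -/(config_size C); lia.
case/orP => [/eqP u_r | w_u]; apply: (pebble_movable_move vu C_ge2).
  by exists [::] => //=; rewrite u_r ffunE eqxx addn1.
by apply: IHn => //; have := sum_move_along w u C_ge2; lia.
Qed.

Lemma tree_strategy_bound r w : tree_strategy r w ->
  weight_bound r w (\sum_v w v).
Proof.
move=> strat_w C unsolvable; rewrite leqNgt.
by apply/negP => /(tree_strategy_movable strat_w).
Qed.

Lemma weight_bound_sum (I : eqType) (s : seq I) r (w : I -> G -> nat) b :
  {in s, forall i, weight_bound r (w i) (b i)} ->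
  weight_bound r (fun v => \sum_(i <- s) w i v) (\sum_(i <- s) b i).
Proof.
move=> bound_w C unsolvable.
under eq_bigr do rewrite big_distrl /=.
rewrite exchange_big big_seq [leqRHS]big_seq.
by apply: leq_sum => i s_i; apply: bound_w.
Qed.

Lemma weight_bound_scale k r w b : weight_bound r w b ->
  weight_bound r (fun v => k * w v) (k * b).
Proof.
move=> bound_w C unsolvable; under eq_bigr do rewrite -mulnA.
by rewrite -big_distrr leq_mul //; apply: bound_w.
Qed.

Lemma rooted_pebbling_number_le r w b m k : weight_bound r w b ->
  (forall v, v != r -> m <= w v) -> b < m * k ->
  rooted_pebbling_number G r <= k.
Proof.
move=> bound_w m_w lt_b; rewrite /rooted_pebbling_number.
case: ex_minnP => n _; apply; apply/asboolP => C size_C.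
apply: contrapT => unsolvable.
have C_r : C r = 0.
  by apply/eqP; rewrite -leqn0 leqNgt; apply/negP => Cr; apply: unsolvable; exists [::].
have := bound_w C unsolvable; apply/negP; rewrite -ltnNge (leq_trans lt_b) //.
rewrite -size_C /config_size big_distrr; apply: leq_sum => v _ /=.
by have [->|/m_w m_le] := eqVneq v r; rewrite ?C_r ?muln0 // leq_mul.
Qed.

(** Since [G] is finite, an injective self-map preserving and reflecting
    adjacency is an automorphism of the graph. *)
Definition automorphism (h : G -> G) :=
  injective h /\ {mono h : u v / adj u v}.

(** The configuration [C \o h] is the image of [C] under the inverse of [h], so
    a solution for the root [r] is transported to one for [h r]. *)
Lemma pebble_movable_automorphism h C r : automorphism h ->
  pebble_movable [ffun v => C (h v)] r -> pebble_movable C (h r).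
Proof.
case=> inj_h mono_h [s]; elim: s C => [|D s IHs] C /=.
  by rewrite ffunE => _ C_hr; exists [::].
case/andP=> /existsP[u /existsP[v /and3P[uv]]]; rewrite ffunE => C_u.
have -> : move_along [ffun v => C (h v)] u v
    = [ffun x => move_along C (h u) (h v) (h x)].
  by apply/ffunP => x; rewrite !ffunE !(inj_eq inj_h).
move=> /eqP-> ps ls; apply: (@pebble_movable_move _ (h u) (h v)) => //.
  by rewrite mono_h.
exact: IHs.
Qed.

Lemma automorphism_finv h : automorphism h -> automorphism (finv h).
Proof.
case=> inj_h mono_h; split; first exact: finv_inj.
by move=> u v; rewrite -mono_h !f_finv.
Qed.

Lemma pebble_movable_finv h C r : automorphism h ->
  pebble_movable [ffun v => C (finv h v)] (h r) -> pebble_movable C r.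
Proof.
move=> aut_h /(pebble_movable_automorphism (automorphism_finv aut_h)).
by have [inj_h _] := aut_h; rewrite finv_f.
Qed.

Lemma weight_bound_automorphism h r w b : automorphism h ->
  weight_bound (h r) w b -> weight_bound r (w \o h) b.
Proof.
move=> aut_h bound_w C unsolvable; have [inj_h _] := aut_h.
have := bound_w [ffun v => C (finv h v)].
rewrite (reindex_inj inj_h); under eq_bigr do rewrite ffunE finv_f //.
by apply=> /(pebble_movable_finv aut_h).
Qed.

Lemma rooted_pebbling_number_automorphism h r : automorphism h ->
  rooted_pebbling_number G r <= rooted_pebbling_number G (h r).
Proof.
move=> aut_h; have [inj_h _] := aut_h; rewrite /rooted_pebbling_number.
case: (ex_minnP (all_movable_exists (h r))) => k /asboolP movable_k _.
case: ex_minnP => n _; apply; apply/asboolP => C size_C.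
apply: pebble_movable_finv aut_h _; apply: movable_k.
rewrite -size_C /config_size (reindex_inj inj_h); apply: eq_bigr => v _.
by rewrite ffunE finv_f.
Qed.

End WeightFunctions.

(** * Automorphisms of Cartesian products *)

Section Products.
Implicit Types G H : connected_graph.

Lemma automorphism_prod G H (f : G -> G) (g : H -> H) :
  automorphism f -> automorphism g ->
  automorphism (G := cartesian_product G H) (fun v => (f v.1, g v.2)).
Proof.
move=> [inj_f mono_f] [inj_g mono_g]; split.
  by move=> [x1 x2] [y1 y2] /= [/inj_f-> /inj_g->].
by move=> u v; rewrite /= /cart_adj /= !mono_f !mono_g (inj_eq inj_f) (inj_eq inj_g).
Qed.

Lemma automorphism_swap G :
  automorphism (G := cartesian_product G G) (fun v => (v.2, v.1)).
Proof.
split; first by move=> [x1 x2] [y1 y2] /= [-> ->].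
by move=> u v; rewrite /= /cart_adj orbC.
Qed.

Lemma automorphism_id G : automorphism (G := G) id.
Proof. by split. Qed.

Lemma eq_automorphism G (f g : G -> G) :
  f =1 g -> automorphism f -> automorphism g.
Proof.
move=> fg [inj_f mono_f]; split; first exact: eq_inj inj_f fg.
by move=> u v; rewrite -!fg.
Qed.

Lemma automorphism_comp G (f g : G -> G) :
  automorphism f -> automorphism g -> automorphism (f \o g).
Proof.
move=> [inj_f mono_f] [inj_g mono_g]; split; first exact: inj_comp.
by move=> u v /=; rewrite mono_f mono_g.
Qed.

(** The exchange of [a] and [b], as a function that reduces by computation. *)
Definition transposition (T : eqType) (a b x : T) :=
  if x == a then b else if x == b then a else x.

Lemma automorphism_twins G (a b : G) : adj a =1 adj b ->
  automorphism (transposition a b).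
Proof.
move=> twins.
have inv : involutive (transposition a b).
  move=> x; rewrite /transposition.
  by case: (eqVneq x a) => [->|/negPf xa]; [|case: (eqVneq x b) => [->|/negPf xb]];
     rewrite ?eqxx ?xa ?xb //; case: eqP.
split; first exact: inv_inj.
have adjE u v : adj (transposition a b u) v = adj u v.
  by rewrite /transposition; case: eqP => [->|_]; [|case: eqP => [->|_]].
by move=> u v; rewrite adjE adj_sym adjE adj_sym.
Qed.
End Products.

(** * The square of the Lemke graph and its symmetries *)

(** Explicit enumerations are used, so that the final verification computes. *)
Definition ord8 : seq 'I_8 :=
  [:: @Ordinal 8 0 isT; @Ordinal 8 1 isT; @Ordinal 8 2 isT; @Ordinal 8 3 isT;
      @Ordinal 8 4 isT; @Ordinal 8 5 isT; @Ordinal 8 6 isT; @Ordinal 8 7 isT].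

Lemma nth_ord8 i0 (i : 'I_8) : nth i0 ord8 i = i.
Proof. by case: i => [[|[|[|[|[|[|[|[|i]]]]]]]] lti] //; apply: val_inj. Qed.

Lemma mem_ord8 (i : 'I_8) : i \in ord8.
Proof. by rewrite -[i in i \in _](nth_ord8 ord0) mem_nth //= ltn_ord. Qed.

Definition lemke_square := cartesian_product lemke_graph lemke_graph.

Definition square_vertices : seq lemke_square := [seq (i, j) | i <- ord8, j <- ord8].

Lemma mem_square_vertices v : v \in square_vertices.
Proof. by case: v => i j; apply/allpairsP; exists (i, j); rewrite !mem_ord8. Qed.

Lemma sum_square_vertices (f : lemke_square -> nat) :
  \sum_v f v = \sum_(v <- square_vertices) f v.
Proof.
apply: perm_big; apply: uniq_perm; first exact: index_enum_uniq.
  by vm_compute.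
by move=> v; rewrite mem_index_enum mem_square_vertices.
Qed.

(** The six permutations of v5, v6, v7, which all have the neighbours v3, v4, v8;
    any index from 6 on stands for the identity, like 0. *)
Definition twin_perm (k : nat) : lemke_graph -> lemke_graph :=
  let v5 := @Ordinal 8 4 isT in
  let v6 := @Ordinal 8 5 isT in
  let v7 := @Ordinal 8 6 isT in
  match k with
  | 1 => transposition v5 v6
  | 2 => transposition v5 v7
  | 3 => transposition v6 v7
  | 4 => transposition v5 v6 \o transposition v6 v7
  | 5 => transposition v6 v7 \o transposition v5 v6
  | _ => id
  end.

Lemma automorphism_twin_perm k : automorphism (twin_perm k).
Proof.
have twins (i j : lemke_graph) : i \in drop 4 (take 7 ord8) ->
    j \in drop 4 (take 7 ord8) -> automorphism (transposition i j).
  move=> twin_i twin_j; apply: automorphism_twins => k'.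
  have : all (fun k => lemke_adj i k == lemke_adj j k) ord8.
    by move: i j twin_i twin_j => [[|[|[|[|[|[|[|[|i]]]]]]]] lti] //
      [[|[|[|[|[|[|[|[|j]]]]]]]] ltj].
  by move/allP/(_ k' (mem_ord8 k'))/eqP.
have id_aut : automorphism (@id lemke_graph) by apply: automorphism_id.
by case: k => [|[|[|[|[|[|k]]]]]] //=; do ?apply: automorphism_comp;
  apply: twins.
Qed.

(** The symmetry of code [(e, k, l)]: the coordinates are exchanged if [e] holds,
    then permuted by the permutations of indices [k] and [l]. *)
Definition symmetry (c : bool * nat * nat) (v : lemke_square) : lemke_square :=
  let: (e, k, l) := c in
  let: (i, j) := if e then (v.2, v.1) else v in (twin_perm k i, twin_perm l j).

Lemma automorphism_symmetry c : automorphism (symmetry c).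
Proof.
case: c => [[e k] l].
have aut_kl := automorphism_prod (automorphism_twin_perm k)
  (automorphism_twin_perm l).
case: e; last by apply: eq_automorphism aut_kl => -[].
apply: eq_automorphism (automorphism_comp aut_kl (automorphism_swap _)) => //.
Qed.

Definition symmetries : seq (bool * nat * nat) :=
  [seq (c, l) | c <- [seq (e, k) | e <- [:: false; true], k <- iota 0 6],
                l <- iota 0 6].

(** * Certificates *)

(** The decimal digits of a numeral, leading zeros included. *)
Fixpoint digits (d : Decimal.uint) : seq nat :=
  match d with
  | Decimal.Nil => [::]
  | Decimal.D0 d' => 0 :: digits d'
  | Decimal.D1 d' => 1 :: digits d'
  | Decimal.D2 d' => 2 :: digits d'
  | Decimal.D3 d' => 3 :: digits d'
  | Decimal.D4 d' => 4 :: digits d'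
  | Decimal.D5 d' => 5 :: digits d'
  | Decimal.D6 d' => 6 :: digits d'
  | Decimal.D7 d' => 7 :: digits d'
  | Decimal.D8 d' => 8 :: digits d'
  | Decimal.D9 d' => 9 :: digits d'
  end.

(** A table with 8 rows and 8 columns as a function on the vertices: the entry
    for the vertex (v_i, v_j) is in row i and column j. *)
Definition lookup T (x0 : T) (t : seq (seq T)) (v : lemke_square) : T :=
  nth x0 (nth [::] t (v.1 : 'I_8)) (v.2 : 'I_8).

Definition tabulate T (f : lemke_square -> T) : seq (seq T) :=
  [seq [seq f (i, j) | j <- ord8] | i <- ord8].

Lemma lookup_tabulate T (x0 : T) (f : lemke_square -> T) v :
  lookup x0 (tabulate f) v = f v.
Proof.
case: v => i j; rewrite /lookup (nth_map i) ?(nth_map j) ?nth_ord8 //=;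
  exact: ltn_ord.
Qed.

(** A tree is given by the table of the depths of its vertices, counted from the
    root; depth 0 means that the weight is zero, at the root or outside the
    tree. *)
Definition depth := lookup 0.

(** The weight at depth [d] is [2 ^ (9 - d)] for [0 < d <= 9], and 0 otherwise. *)
Definition depth_weight (d : nat) : N :=
  nth 0%num [:: 0; 256; 128; 64; 32; 16; 8; 4; 2; 1]%num d.

(** The vertices that share a coordinate with [v]; they include its neighbours. *)
Definition cross (v : lemke_square) : seq lemke_square :=
  [seq (i, v.2) | i <- ord8] ++ [seq (v.1, j) | j <- ord8].

(** Each vertex of depth 1 is adjacent to the root [r], and each deeper vertex has
    a neighbour of depth one less. *)
Definition is_tree (r : lemke_square) (t : seq (seq nat)) : bool :=
  all (fun v => match depth t v with
                | 0 => true
                | 1 => adj v r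
                | d.+1 => has (fun u => (depth t u == d) && adj v u) (cross v)
                end) square_vertices.

Lemma is_tree_strategy r t : is_tree r t ->
  tree_strategy r (fun v => depth_weight (depth t v) : nat).
Proof.
move=> /allP tree_t v; have {tree_t} := tree_t v (mem_square_vertices v).
case: (depth t v) => [|[|d]] // => [vr _ | /hasP[u _]].
  by exists r; rewrite ?eqxx.
case/andP=> /eqP du vu w_gt0; exists u => //; rewrite du; apply/orP; right.
move: d w_gt0 {du} => [|[|[|[|[|[|[|[|d]]]]]]]];
  by rewrite // /depth_weight nth_default.
Qed.

(** A sum in binary natural numbers that reduces by computation. *)
Definition Nsum T (f : T -> N) (s : seq T) : N := foldr N.add 0%num (map f s).

Lemma eq_Nsum T (f g : T -> N) s : f =1 g -> Nsum f s = Nsum g s.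
Proof. by move=> fg; rewrite /Nsum (eq_map fg). Qed.

Lemma nat_of_Nsum T (f : T -> N) s :
  nat_of_bin (Nsum f s) = \sum_(x <- s) f x.
Proof.
by elim: s => [|x s IHs]; rewrite ?big_nil // big_cons -IHs /Nsum /=; lia.
Qed.

(** The combination of the weights of the trees [t.2] with multiplicities
    [t.1]. *)
Definition total_weight (ts : seq (N * seq (seq nat))) (v : lemke_square) : N :=
  Nsum (fun t => t.1 * depth_weight (depth t.2 v))%num ts.

(** A row of depths, written as a decimal numeral; hexadecimal numerals are not
    meant to occur. *)
Definition row (d : Number.uint) : seq nat :=
  if d is Number.UIntDecimal d' then digits d' else [::].

(** A tree with its multiplicity [k], given by its eight rows of depths. *)
Definition tree (k : N) (d1 d2 d3 d4 d5 d6 d7 d8 : Number.uint) :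
    N * seq (seq nat) :=
  (k, map row [:: d1; d2; d3; d4; d5; d6; d7; d8]).

Arguments tree k%_N_scope (d1 d2 d3 d4 d5 d6 d7 d8)%_dec_uint_scope.

(** A root (i, j), standing for the vertex (v_i, v_j), and a list of trees with
    multiplicities; the level is a lower bound, at every vertex other than the
    root, for their combined weight averaged over the symmetries that fix the
    root. *)
Record certificate := Certificate {
  cert_root : nat * nat;
  cert_level : N;
  cert_trees : seq (N * seq (seq nat))
}.

(** The labels start from 1, the ordinals from 0. *)
Definition root_of (c : certificate) : lemke_square :=
  (nth ord0 ord8 (cert_root c).1.-1, nth ord0 ord8 (cert_root c).2.-1).

(** With [w] the combined weight and [hs] the symmetries fixing the root [r], the
    sum over [h] in [hs] of the weights [w \o h] is at least [m] outside [r], and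
    its total, [size hs] times that of [w], is less than [m * 96]. *)
Definition certifies (c : certificate) : bool :=
  let r := root_of c in
  let ts := cert_trees c in
  let w := tabulate (total_weight ts) in
  let hs := [seq h <- symmetries | symmetry h r == r] in
  let m := (N.of_nat (size hs) * cert_level c)%num in
  [&& all (is_tree r) (map snd ts),
      all (fun v => (v == r) ||
             N.leb m (Nsum (fun h => lookup 0%num w (symmetry h v)) hs))
          square_vertices,
      N.ltb (Nsum (lookup 0%num w) square_vertices) (96 * cert_level c)%num
    & 0 < size hs].

Lemma certifies_bound c : certifies c ->
  rooted_pebbling_number lemke_square (root_of c) <= 96.
Proof.
rewrite /certifies; set r := root_of c; set ts := cert_trees c.
set hs := [seq h <- _ | _]; set m := cert_level c.
move=> /and4P[/allP trees_ok /allP level_ok total_ok hs_gt0].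
pose w := total_weight ts.
have bound_w : weight_bound r (fun v => w v : nat) (\sum_v w v).
  have wE v : w v = \sum_(t <- ts) t.1 * depth_weight (depth t.2 v) :> nat.
    by rewrite /w nat_of_Nsum; apply: eq_bigr => t _; lia.
  rewrite (boolp.funext wE).
  under [b in weight_bound r _ b]eq_bigr do rewrite wE.
  rewrite exchange_big; apply: weight_bound_sum => t ts_t.
  rewrite -big_distrr; apply/weight_bound_scale/tree_strategy_bound.
  by apply/is_tree_strategy/trees_ok/map_f.
have bound_hs : weight_bound r (fun v => \sum_(h <- hs) w (symmetry h v))
    (size hs * \sum_v w v).
  rewrite -sum1_size big_distrl /=; under eq_bigr do rewrite mul1n.
  apply: weight_bound_sum => h; rewrite mem_filter => /andP[/eqP hr _].
  apply: (@weight_bound_automorphism _ (symmetry h) r (fun v => w v)).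
    exact: automorphism_symmetry.
  by rewrite hr.
apply: (rooted_pebbling_number_le (m := size hs * m) bound_hs).
  move=> v /negPf v_r; have := level_ok v (mem_square_vertices v).
  rewrite v_r (eq_Nsum _ (fun h => lookup_tabulate _ _ (symmetry h v))) => /N.leb_le.
  have := nat_of_Nsum (fun h => w (symmetry h v)) hs; rewrite -/w -/m; lia.
rewrite -mulnA ltn_pmul2l // sum_square_vertices; move: total_ok.
rewrite (eq_Nsum _ (lookup_tabulate _ _)) => /N.ltb_lt.
have := nat_of_Nsum w square_vertices; rewrite -/w; lia.
Qed.

(** * The weighted trees *)

(** One certificate for each of the 22 orbits of roots. *)
Definition certificates : seq certificate := [::
  Certificate (1, 1) 896 [::
      tree 22 00100203 00005304 00000000 00000865 00077076 00000776 00087976 00078776;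
      tree  7 00000000 10200000 00000000 00304447 00505067 00005006 00465576 00406556;
      tree 15 00000000 10000000 00000090 23045597 04068000 04058787 04058687 00057666;
      tree 12 00100200 00000304 00008300 00000605 00000807 00007776 00057476 00060076;
      tree 21 00000000 10205576 00000000 00354446 00005667 00065056 00775676 07465556;
      tree  8 00100203 00000304 00000004 00000095 00000076 00900089 00000000 00000076;
      tree 20 00000000 00000000 10203334 00076060 00504445 00056645 00004405 00065556;
      tree  7 01000000 02030000 00000900 03090000 04000807 00080987 00000000 04050006];
  Certificate (1, 2) 192 [::
      tree  2 00007000 01425350 00006000 00734444 00706065 00065055 00685605 00675565;
      tree  2 10200500 00304445 00304440 00467656 00087558 00505556 00505556 00596667;
      tree  5 00000000 00700600 81007577 00667555 70606766 00707666 32434444 43565555;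
      tree  2 00000000 01500667 00000000 32434556 00505666 00576666 40656706 05545565;
      tree  2 00015000 80700860 00024503 00005955 80706664 00534444 00734544 90645555;
      tree  2 00012022 00000033 00603033 00866755 00074869 00500040 00676564 70665855;
      tree  2 10000500 20308465 20300645 40587667 30475556 30405556 00405550 50506667];
  Certificate (1, 3) 128 [::
      tree  2 00000000 05152005 00000006 34243554 45065765 05054000 45064675 55054675;
      tree  1 00000000 00000000 23100200 06050478 06000306 34050354 36067577 65550465;
      tree  3 00000000 00000000 00100000 07054765 56005006 76075776 05243854 45354645;
      tree  1 00000000 23132243 06070076 54050554 06000060 00067065 05000075 05060065;
      tree  2 00021003 00030044 00032403 07056605 65043504 05043554 87045506 76054005;
      tree  1 12000000 03000000 03040005 06000700 54056606 54050066 54056676 05067007];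
  Certificate (1, 4) 372 [::
      tree 12 00000000 80700000 50010004 65600454 00600000 43423333 75600505 54504065;
      tree  5 00000000 00010000 00700000 43420036 56605000 60800505 50600755 50534444;
      tree  3 21500000 30400000 30000000 49507000 48500060 45506000 56000000 57600000;
      tree  3 00000001 00003002 00000002 00004003 00000504 00000000 80000000 70605754;
      tree  9 00200100 00300200 00300200 80608600 70407500 00007500 70000354 60556465;
      tree  3 01000000 32400500 32400000 50500060 40500079 45700000 40600009 50600978];
  Certificate (1, 5) 959 [::
      tree 11 00000000 06001004 06500665 45332643 56460554 55440554 56600564 55540556;
      tree  6 00100400 07500000 30200330 56400050 45060445 45300645 45360640 56000556;
      tree 23 00000000 00000000 70801076 96060600 66352605 87900667 66050605 55443554;
      tree  8 00000000 80000000 00021500 75600550 86030447 04030444 84930444 65700556;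
      tree  7 90000000 36221330 80000009 45930445 76800506 66060576 56070908 56000550;
      tree 16 72010220 73040300 63000334 65000550 54000445 54800445 54000445 65700556;
      tree  5 00000001 76000332 09000005 65040443 76050076 00950054 78960054 76800954;
      tree  7 20100000 30000000 34000000 46000000 45000000 45500600 55000800 56600700];
  Certificate (1, 8) 1534 [::
      tree  9 00000000 00000000 80000001 06740000 76607000 54630502 70600750 65564443;
      tree 16 00000000 00000000 43020001 75645500 76070600 54630000 54700000 65740600;
      tree 12 00000000 80000001 00000000 77063332 08000000 80050400 77664000 66554600;
      tree 36 00000000 00000000 00000201 78800400 55445350 77800300 80000300 66756500;
      tree 25 00000000 00000000 69708001 66745560 06607758 54633042 78605056 65564643;
      tree 36 00000000 40300201 08000000 50400000 69000000 67708000 67700080 60700000;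
      tree 12 50010000 43020000 60000000 54809000 67000000 67090000 67900000 67780800;
      tree 28 00200100 70000000 45300000 67600070 50400000 56607070 78400500 67500660;
      tree 21 32010000 43000000 00000000 54050000 60000000 66000000 65000000 65000000];
  Certificate (2, 2) 223 [::
      tree  4 00005667 00004000 00545556 21523304 30434444 30444455 40534454 30434444;
      tree  6 60008000 00000000 50607766 01500700 43565606 45505555 02596855 32434444;
      tree  6 41005006 00000000 32434444 00000060 40566655 40505555 40580555 00677666];
  Certificate (2, 3) 253 [::
      tree  6 00000005 00000004 05060045 23147023 34008004 04056634 54048034 34056004;
      tree  3 07000050 00000000 46060045 00100000 45245334 55054045 35243354 34243334;
      tree  3 84030000 00020010 75046565 00030000 75046505 65045565 65045556 65045706;
      tree  3 25104223 00000004 34243334 00007000 65754485 05556445 45054645 06060756;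
      tree  2 03040605 12000000 54059666 03009000 64050766 54068087 04967877 04056006];
  Certificate (2, 4) 495 [::
      tree  8 00304240 00200100 50405467 00308200 60506360 56406357 57405356 56477377;
      tree  2 50010420 60000000 43423333 07607598 56554467 54554444 50555444 65605506;
      tree  9 80000602 00000001 78665543 00605772 60505543 70554643 60546403 60544443;
      tree  8 32000000 01000000 43586877 32000000 45500089 43576667 43500808 44557767;
      tree  4 30400000 21000000 46506767 36809708 45506667 45507678 45509708 45587667;
      tree  3 00000000 00000000 54534464 04016455 43523443 43420334 43423453 54555054];
  Certificate (2, 5) 478 [::
      tree 11 60570600 00100060 56460570 30200550 57570567 45350440 45370560 45304445;
      tree  5 66000000 70000000 55440554 05001570 66770867 44332443 45342443 55065554;
      tree  3 90000300 00000201 86067554 70000562 76800553 65040503 86500443 65545443;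
      tree  5 43550607 02010000 54040556 43020300 54030440 04034645 55050450 54030445;
      tree  4 36600300 20100200 45500668 34090700 45080870 45090879 45570667 45687078;
      tree  6 05421532 90000000 54332443 80900665 65040554 05000550 65640570 76770667];
  Certificate (2, 8) 256 [::
      tree  6 78890000 00000000 67080060 00502001 55443050 55443050 75503072 54433342;
      tree  3 60006221 00000000 55445330 78600000 60506460 66708049 66050460 77689770;
      tree  4 00000000 00010000 65647000 63820000 54658768 54534060 54676000 54745550;
      tree  4 43020000 32010000 54600000 40000000 55698000 55700000 56079008 56687000;
      tree  4 45300000 00200010 50500000 40300000 50405500 50000000 57000000 56006000;
      tree  2 60500401 00000000 55445332 00000000 66556445 66556460 67050445 77667556];
  Certificate (3, 3) 108 [::
      tree  3 06030203 65045054 00000102 06070064 00004263 06066405 06000003 05045354;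
      tree  2 54030203 05045554 00020104 05045364 04034203 04036243 76000203 65045304;
      tree  2 23000000 04057766 12000000 04056066 03040000 03045505 05060077 04867776];
  Certificate (3, 4) 132 [::
      tree  2 00500263 50400354 70200100 50405460 40300240 67506060 40304405 56405350;
      tree  2 67000000 56605778 00000000 45744354 56500504 00800440 32413222 43440333;
      tree  2 34400000 40500000 21000000 43556060 54600700 54007068 32600070 43547650;
      tree  1 50403332 60504445 00000001 60576063 00605054 00403532 00607070 60506665;
      tree  2 54614078 43423333 00000000 54555404 60800000 00000076 60000000 60776605];
  Certificate (3, 5) 121 [::
      tree  1 43020356 54530440 02010020 67500545 43000630 43000706 03440630 54050045;
      tree  3 06000000 55000650 07000000 44430540 50400050 34221333 00040500 44334445;
      tree  1 08000332 67500443 00000001 78550543 70600502 87660556 00000332 66550443;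
      tree  1 34600370 45500460 20100200 45500480 34680579 00600378 34400550 45690566;
      tree  2 30201002 44332443 00000000 56043554 00880770 70000000 77700607 67074667];
  Certificate (3, 8) 304 [::
      tree  5 45500060 56600700 30201000 57465770 45300400 40002000 45500680 56400090;
      tree  8 78000000 67790080 70000000 58496042 09000000 69000000 00306021 56405533;
      tree  3 03000000 54600000 02010000 50700000 60700000 43000000 05000000 54000000;
      tree  5 45300021 54433332 00000000 60000040 70000000 89000000 70800000 70000000;
      tree  4 60723000 54630470 50010000 64034080 65000000 67005000 43020000 58600000;
      tree  5 60800000 65700500 50010000 54605400 43023300 60706000 00000500 54034000];
  Certificate (4, 4) 64 [::
      tree  1 60000000 00000000 56500000 00000000 40000000 00400534 47000004 32312423;
      tree  2 50578645 70607700 43423334 00400000 54004445 32312442 54004040 67405500;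
      tree  1 43590800 32600000 40600778 21000000 30405000 60500000 32000080 32405000];
  Certificate (4, 5) 216 [::
      tree  1 66070860 00000000 55060056 00000700 76530643 44300445 44500845 33221332;
      tree  2 44300443 33221332 55477586 40000090 60700607 60000000 80700687 70000008;
      tree  1 65740443 96800032 65040503 00000051 05640453 06050443 06000332 07000442;
      tree  3 55400550 06000060 44350444 05000000 56460550 66600556 43221433 54550660;
      tree  1 54000550 63780667 54030444 02010640 43000500 43020035 03600550 53020300;
      tree  2 45050465 30000300 45556546 25100220 37280455 34540334 34000304 36450336;
      tree  3 44332443 05001556 55643554 76000000 67000005 07000000 67700000 00000000];
  Certificate (4, 8) 320 [::
      tree  2 78000050 00000000 67000040 60000000 50600030 70000030 58403330 40302221;
      tree  5 50465334 40330221 69700040 09000000 70000000 90809050 78000050 80900000;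
      tree  4 54650000 43000000 54607090 02010000 43020000 43798080 43506600 54600000;
      tree  5 56004000 45000000 56403504 30201000 47302000 47000000 45002000 46400000;
      tree  7 65660070 00000000 54530400 00000000 60740500 43320231 67000070 64536460;
      tree  5 56445352 00500061 60000043 00000000 70000000 00000000 00000000 00000000];
  Certificate (5, 5) 92 [::
      tree  1 54000540 54550445 63020030 03020336 04010060 54050646 54650445 05060050;
      tree  2 44332443 55667554 55241552 50600650 00000600 44332045 66057666 05000006;
      tree  1 67700879 56600660 05600050 47600550 00000000 44330443 45550443 34221332;
      tree  1 54030054 64045555 43420533 53000556 02010200 54530465 54050445 43040300];
  Certificate (5, 6) 102 [::
      tree  1 54050060 54700070 43000050 43646000 32010020 50534045 54076868 53025033;
      tree  1 76054056 65544643 00003064 06603052 00002071 07584003 07704080 07700000;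
      tree  1 45504045 56005056 30203036 45000050 45104000 45054040 45054045 34253034;
      tree  1 76706000 75045060 67005000 64034050 04005000 54554064 54535044 43023133;
      tree  1 55045054 44334243 60700000 55607100 00008000 45334265 80706007 90005006;
      tree  1 76405056 45304040 55000000 50245134 06000000 44334243 45364740 55000000;
      tree  1 44334243 55065056 43025154 60076007 00000060 54600065 54607060 05000000];
  Certificate (5, 8) 248 [::
      tree  3 54533432 65707506 60000001 66000000 00000000 54030032 70000000 65040000;
      tree  2 54650060 55060000 63000000 40000000 32010000 54600000 54600000 43545000;
      tree  2 78890000 69700000 60000000 54500000 00000000 54443332 54634740 43620051;
      tree  2 60040500 54630400 00000000 03020001 00000000 54600000 54600000 00000000;
      tree  7 56404000 55443554 40302000 40302000 00001000 50403000 50405000 60002000;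
      tree  2 54050600 65700700 63020001 60700000 00000000 54000000 54830990 60708000;
      tree  3 56600000 56000000 40000000 45500000 30201000 50603000 50603770 40302000];
  Certificate (8, 8) 250 [::
      tree  6 65045655 54630040 00000000 60020000 00000000 00000000 00000000 00010000;
      tree  7 65745043 06000000 54834402 70000000 67705201 00040000 60000000 80000000;
      tree  5 67000000 67000000 58400000 50000000 69000000 60000000 40300021 00000000;
      tree  4 60708800 56600000 60000000 44500000 53000000 43600000 50600000 32010000;
      tree 10 65600000 70000000 54504000 00000000 05000000 43423001 00000000 00000000]].

(** * The bound for every root *)

Lemma certificates_certify : all certifies certificates.
Proof. by vm_compute. Qed.

(** Every root is carried by a symmetry to the root of a certificate. *)
Lemma certificates_cover :
  all (fun r => has (fun h => has (fun c => symmetry h r == root_of c)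
                                  certificates) symmetries) square_vertices.
Proof. by vm_compute. Qed.

Theorem theorem4p2 (r1 r2 : lemke_graph) :
  rooted_pebbling_number
    (cartesian_product lemke_graph lemke_graph) (r1, r2) <= 96.
Proof.
have /hasP[h _ /(has_nthP (Certificate (1, 1) 0 [::]))[k lt_k /eqP h_r]] :=
  allP certificates_cover (r1, r2) (mem_square_vertices _).
apply: leq_trans (rooted_pebbling_number_automorphism _
                    (automorphism_symmetry h)) _.
rewrite h_r; apply: certifies_bound.
exact: (all_nthP _ certificates_certify).
Qed.
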